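(* Let $D$ be a non-commutative division ring with center $F$ which is algebraic over $F$ and weakly locally finite, let $n\ge1$, and let $N$ be a subgroup of $\mathrm{GL}_n(D)$ containing $F^*I=\{\alpha I\mid\alpha\in F^*\}$. Then $N$ is not finitely generated.
   Context: A division ring $D$ is weakly locally finite if for every finite subset $S\subseteq D$, the division subring generated by $S$ is finite dimensional over its own center. $D$ is algebraic over $F$ if every element is algebraic over $F$. $I$ is the identity matrix. *)

(* Defs.v *)
From HB Require Import structures.
From mathcomp Require Import all_boot all_order all_algebra.
Set Implicit Arguments. Unset Strict Implicit. Unset Printing Implicit Defensive.
Import GRing.Theory.
Local Open Scope ring_scope.

Definition division_ring (D : unitRingType) : Prop :=
  forall x : D, x != 0 -> x \is a GRing.unit.

Definition noncommutative (D : unitRingType) : Prop :=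
  exists x y : D, x * y != y * x.

Definition central (D : unitRingType) (x : D) : Prop := forall y : D, x * y = y * x.

Definition algebraic_over_center (D : unitRingType) : Prop :=
  forall x : D, exists p : {poly D},
    p != 0 /\ (forall i, central p`_i) /\ p.[x] = 0.

Definition is_division_subring (D : unitRingType) (T : D -> Prop) : Prop :=
  [/\ T 1,
      (forall x y, T x -> T y -> T (x - y)),
      (forall x y, T x -> T y -> T (x * y)) &
      (forall x, T x -> x != 0 -> T x^-1)].

Definition gen_division_subring (D : unitRingType) (S : seq D) : D -> Prop :=
  fun x => forall T : D -> Prop, is_division_subring T ->
    (forall s, s \in S -> T s) -> T x.

Definition center_of (D : unitRingType) (K : D -> Prop) : D -> Prop :=
  fun z => K z /\ forall k, K k -> z * k = k * z.

Definition fin_dim_over_center (D : unitRingType) (K : D -> Prop) : Prop :=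
  exists b : seq D, (forall v, v \in b -> K v) /\
    forall k, K k -> exists c : 'I_(size b) -> D,
      (forall i, center_of K (c i)) /\ k = \sum_(i < size b) c i * b`_i.

Definition weakly_locally_finite (D : unitRingType) : Prop :=
  forall S : seq D, fin_dim_over_center (gen_division_subring S).

Definition in_GL (D : unitRingType) (n : nat) (A : 'M[D]_n) : Prop :=
  exists B : 'M[D]_n, A *m B = 1%:M /\ B *m A = 1%:M.

Definition is_subgroup_GL (D : unitRingType) (n : nat) (N : 'M[D]_n -> Prop) : Prop :=
  [/\ (forall A, N A -> in_GL A),
      N 1%:M,
      (forall A B, N A -> N B -> N (A *m B)) &
      (forall A B, N A -> A *m B = 1%:M -> B *m A = 1%:M -> N B)].

Definition finitely_generated_GL (D : unitRingType) (n : nat) (N : 'M[D]_n -> Prop) : Prop :=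
  exists s : seq 'M[D]_n, (forall A, A \in s -> N A) /\
    forall H : 'M[D]_n -> Prop, is_subgroup_GL H ->
      (forall A, A \in s -> H A) -> forall A, N A -> H A.

(* Main.v *)
Require Import Defs.
From HB Require Import structures.
From mathcomp Require Import all_boot all_order all_algebra.
From mathcomp Require Import all_field boolp.
Import Order.TTheory GRing.Theory Num.Theory.
Local Open Scope ring_scope.
Set Implicit Arguments. Unset Strict Implicit. Unset Printing Implicit Defensive.

(** Suppose that [N] is generated by finitely many matrices, let [X] collect the
    entries of these matrices and of their inverses together with two
    non-commuting elements, and let [K] be the division subring generated by
    [X], with center [E] and finite basis [b] over [E].  A finitely generated
    subring [P] of [E] contains the structure constants of [b] and the
    coordinates of [1] and of [X], so the [P]-span [L] of [b] is a subring
    containing [X].  The entries of every matrix of [N] lie in [L]; hence so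
    does [F], and in fact [F] is contained in [P] once the inverse of a nonzero
    coordinate of [1] is put in [P].  Being algebraic over [F], the domain [P]
    is a field, and a field that is finitely generated as a ring is finite.
    Thus [L] is a finite domain, hence commutative by Wedderburn's little
    theorem, although it contains two non-commuting elements.

    The finiteness of [P] follows Kaplansky and Artin-Tate: if [R[s]] is a
    field, then [s] is integral over [R[1/b]] for some nonzero [b] in [R]; for
    [R = int] this excludes characteristic 0. *)

(** * Ring extensions inside a field by finitely many elements *)

Definition adjoin_morph (R : comNzRingType) (E : fieldType) (f : {rmorphism R -> E})
    (t : E) : {rmorphism {poly R} -> E} :=
  horner_morph (fun a => mulrC t (f a)).
Arguments adjoin_morph : simpl never.

(* The subring [f(R)[s]] of [E] as the image of an iterated polynomial ring. *)
Fixpoint adjoin_seq (E : fieldType) (s : seq E) (R : comNzRingType)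
    (f : {rmorphism R -> E}) (x : E) : Prop :=
  if s is t :: s' then adjoin_seq s' (adjoin_morph f t) x else exists r, x = f r.

Section Adjoin.

Variable E : fieldType.
Implicit Types (R : comNzRingType) (s : seq E) (x t : E).

Lemma adjoin_morphE R (f : {rmorphism R -> E}) t p :
  adjoin_morph f t p = (map_poly f p).[t].
Proof. by []. Qed.

Lemma adjoin_morphC R (f : {rmorphism R -> E}) t r : adjoin_morph f t r%:P = f r.
Proof. exact: horner_morphC. Qed.

Lemma adjoin_morphX R (f : {rmorphism R -> E}) t : adjoin_morph f t 'X = t.
Proof. exact: horner_morphX. Qed.

(** Closure properties of [adjoin_seq] are read off from this single morphism instead of being
    proved by induction on [s]. *)
Lemma adjoin_seq_range s R (f : {rmorphism R -> E}) :
  exists (R' : comNzRingType) (f' : {rmorphism R' -> E}),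
    forall x, adjoin_seq s f x <-> exists r, x = f' r.
Proof. by elim: s R f => [|t s IHs] R f /=; [exists R, f | apply: IHs]. Qed.

Lemma adjoin_seq_base s R (f : {rmorphism R -> E}) r : adjoin_seq s f (f r).
Proof.
elim: s R f r => [|t s IHs] R f r /=; first by exists r.
by rewrite -(adjoin_morphC f t); apply: IHs.
Qed.

Lemma adjoin_seq_mem s R (f : {rmorphism R -> E}) t :
  t \in s -> adjoin_seq s f t.
Proof.
elim: s R f => //= u s IHs R f; rewrite inE => /predU1P[-> | /IHs //].
by rewrite -{2}(adjoin_morphX f u); apply: adjoin_seq_base.
Qed.

Lemma adjoin_seqB s R (f : {rmorphism R -> E}) x y :
  adjoin_seq s f x -> adjoin_seq s f y -> adjoin_seq s f (x - y).
Proof.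
have [R' [g gP]] := adjoin_seq_range s f.
by move=> /gP[a ->] /gP[b ->]; apply/gP; exists (a - b); rewrite rmorphB.
Qed.

Lemma adjoin_seqM s R (f : {rmorphism R -> E}) x y :
  adjoin_seq s f x -> adjoin_seq s f y -> adjoin_seq s f (x * y).
Proof.
have [R' [g gP]] := adjoin_seq_range s f.
by move=> /gP[a ->] /gP[b ->]; apply/gP; exists (a * b); rewrite rmorphM.
Qed.

Lemma adjoin_seq_sum s R (f : {rmorphism R -> E}) (I : Type) (r : seq I)
    (F : I -> E) :
  (forall i, adjoin_seq s f (F i)) -> adjoin_seq s f (\sum_(i <- r) F i).
Proof.
move=> sF; elim/big_ind: _ => // [|x y sx sy].
  by rewrite -(rmorph0 f); apply: adjoin_seq_base.
rewrite -[y]opprK; apply: adjoin_seqB => //; rewrite -sub0r.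
by apply: adjoin_seqB => //; rewrite -(rmorph0 f); apply: adjoin_seq_base.
Qed.

Lemma adjoin_in_range R R' (f : {rmorphism R -> E}) (g : {rmorphism R' -> E}) t :
    (forall r, exists r', f r = g r') -> (exists r', t = g r') ->
  forall p, exists r', adjoin_morph f t p = g r'.
Proof.
move=> fg [u ->]; elim/poly_ind => [|p c [w IHp]]; first by exists 0; rewrite !rmorph0.
have [c' Ec] := fg c.
by exists (w * u + c'); rewrite !rmorphD !rmorphM /= IHp adjoin_morphX adjoin_morphC Ec.
Qed.

(** * Integrality over the image of a ring *)

Lemma integral_map_poly R R' (f : {rmorphism R -> E}) (g : {rmorphism R' -> E})
    (p : {poly R}) :
    (forall r, integralOver g (f r)) ->
  {in map_poly f p : seq E, integralRange g}.
Proof. by move=> int_f; apply/integral_poly => i; rewrite coef_map; apply: int_f. Qed.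

Lemma integral_adjoin R R' (f : {rmorphism R -> E}) (g : {rmorphism R' -> E}) t :
    (forall r, integralOver g (f r)) -> integralOver g t ->
  forall p, integralOver g (adjoin_morph f t p).
Proof.
by move=> int_f int_t p; apply: integral_horner int_t; apply: integral_map_poly.
Qed.

Lemma integral_trans R R' (f : {rmorphism R -> E}) (g : {rmorphism R' -> E}) x :
  (forall r, integralOver g (f r)) -> integralOver f x -> integralOver g x.
Proof.
move=> int_f [p mon_p px0]; apply: integral_root_monic px0 _.
  exact: monic_map.
exact: integral_map_poly.
Qed.

Lemma integral_adjoin_seq R' (g : {rmorphism R' -> E}) s R
    (f : {rmorphism R -> E}) x :
    (forall r, integralOver g (f r)) -> {in s, integralRange g} ->
  adjoin_seq s f x -> integralOver g x.
Proof.
elim: s R f => [|t s IHs] R f int_f int_s /=; first by case=> r ->.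
apply: IHs => [|u su]; last by apply: int_s; rewrite inE su orbT.
by apply: integral_adjoin => //; apply: int_s; rewrite mem_head.
Qed.

(** With [x = g r], multiplying a monic relation of degree [n + 1] for [x^-1] by [x ^+ n] writes
    [x^-1] as a polynomial in [x] with coefficients in the image. *)
Lemma integral_inv_range R (g : {rmorphism R -> E}) r :
  g r != 0 -> integralOver g (g r)^-1 -> exists r', (g r)^-1 = g r'.
Proof.
set x := g r => nz_x [q mon_q]; rewrite rootE horner_coef size_map_poly_id0; last first.
  by rewrite (monicP mon_q) rmorph1 oner_neq0.
rewrite polySpred ?monic_neq0 //; set n := (size q).-1.
rewrite big_ord_recr /= coef_map /= -[n]/((size q).-1) -lead_coefE (monicP mon_q).
rewrite rmorph1 mul1r -/n; case: n => [|n].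
  by rewrite big_ord0 add0r expr0 oner_eq0.
rewrite addrC addr_eq0 => /eqP Ex.
exists (- \sum_(i < n.+1) q`_i * r ^+ (n - i)).
have /(congr1 (fun y => y * x ^+ n)) := Ex.
rewrite exprS -mulrA -exprMn mulVf // expr1n mulr1 => ->.
rewrite rmorphN rmorph_sum mulNr mulr_suml; congr (- _).
apply: eq_bigr => i _; rewrite coef_map /= rmorphM rmorphXn -/x -mulrA; congr (_ * _).
rewrite -[in x ^+ n](@subnK i n) -1?ltnS // exprD mulrCA -exprMn mulVf //.
by rewrite expr1n mulr1.
Qed.

(** * Fields finitely generated as rings over a subring *)

Lemma adjoin_inv_clear R (f : {rmorphism R -> E}) c p :
  f c != 0 -> exists m r, adjoin_morph f (f c)^-1 p * f c ^+ m = f r.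
Proof.
move=> nz_c; elim/poly_ind: p => [|p a [m [r IHp]]].
  by exists 0%N, 0; rewrite !rmorph0 mul0r.
exists m.+1, (r + a * c ^+ m.+1); rewrite !rmorphD !rmorphM /= adjoin_morphX adjoin_morphC.
by rewrite mulrDl !rmorphXn -IHp exprS mulrA mulfVK.
Qed.

(* Dividing the relation [q(x) = 0] by the largest possible power of [x]
   exposes a nonzero coefficient that is a multiple of [x]. *)
Lemma root_dvd_coef R (f : {rmorphism R -> E}) (q : {poly R}) x :
    x != 0 -> map_poly f q != 0 -> (map_poly f q).[x] = 0 ->
  exists i w, f q`_i != 0 /\ f q`_i = x * (map_poly f w).[x].
Proof.
move=> nz_x; elim/poly_ind: q => [|q c IHq]; first by rewrite rmorph0 eqxx.
rewrite rmorphD rmorphM /= map_polyX map_polyC /= hornerMXaddC.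
have [fc0 | nz_fc _ qx0] := eqVneq (f c) 0.
  rewrite fc0 polyC0 !addr0 mulf_eq0 polyX_eq0 orbF => nz_q /eqP.
  rewrite mulf_eq0 (negPf nz_x) orbF => /eqP /(IHq nz_q)[i [w Ew]].
  by exists i.+1, w; rewrite coefD coefMX coefC /= addr0.
exists 0%N, (- q); rewrite coefD coefMX coefC /= add0r; split=> //.
apply/eqP; rewrite rmorphN hornerN mulrN -addr_eq0 addrC mulrC.
exact/eqP.
Qed.

(** An argument in the style of Euclid: if [t] were transcendental, invertibility of [1 + a * 'X] at
    [t] would, after clearing denominators, make this polynomial divide a power of [a]. It is
    coprime to [a] and not constant. *)
Lemma adjoin_field_algebraic R (f : {rmorphism R -> E}) t (a : {poly R}) :
    adjoin_morph f t a != 0 ->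
    (forall x, x != 0 -> adjoin_seq [:: t; (adjoin_morph f t a)^-1] f x ->
       adjoin_seq [:: t; (adjoin_morph f t a)^-1] f x^-1) ->
  exists2 p, map_poly f p != 0 & adjoin_morph f t p = 0.
Proof.
set ft := adjoin_morph f t; set al := ft a => nz_al fieldP.
apply: contrapT => transc.
have ft_inj p : ft p = 0 -> map_poly f p = 0.
  by move=> ftp0; apply/eqP/negPn/negP=> nz_p; apply: transc; exists p.
pose u : {poly R} := a * 'X + 1%:P; pose A := map_poly f a.
have Eu : map_poly f u = A * 'X + 1%:P.
  by rewrite rmorphD rmorphM /= map_polyX map_polyC /= rmorph1.
have nz_A : A != 0.
  by apply: contraNneq nz_al => A0; rewrite /al /ft adjoin_morphE -/A A0 horner0.
have size_u : size (A * 'X + 1%:P) = (size A).+1.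
  by rewrite size_MXaddC (negPf nz_A).
have nz_u : ft u != 0.
  apply: contra_eq_neq size_u => /ft_inj; rewrite Eu => ->.
  by rewrite size_poly0.
have [|r' Er] := fieldP _ nz_u.
  by exists u%:P; rewrite adjoin_morphC.
have [m [w Ew]] := adjoin_inv_clear r' nz_al.
have /eqP : ft (u * w - a ^+ m) = 0.
  rewrite rmorphB rmorphM -Ew -Er rmorphXn mulrA mulfV // mul1r.
  exact: subrr.
move/eqP/ft_inj/eqP; rewrite rmorphB rmorphM rmorphXn /= Eu subr_eq0 -/A => /eqP dvd_A.
have copA : coprimep (A * 'X + 1%:P) (A ^+ m).
  rewrite coprimep_expr // coprimep_sym.
  apply/coprimepP => d dA; rewrite dvdp_addr ?dvdp_mulr // polyC1.
  by rewrite dvdp1 -size_poly_eq1.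
have /coprimepP/(_ _ (dvdpp _)) := copA.
rewrite -dvd_A dvdp_mulIl => /(_ isT); rewrite -size_poly_eq1 size_u eqSS.
by rewrite size_poly_eq0 (negPf nz_A).
Qed.

Lemma integral_root_lead R R' (f : {rmorphism R -> E}) (g : {rmorphism R' -> E})
    (p : {poly R}) x :
    (forall r, integralOver g (f r)) -> map_poly f p != 0 ->
    integralOver g (lead_coef (map_poly f p))^-1 -> (map_poly f p).[x] = 0 ->
  integralOver g x.
Proof.
set P := map_poly f p => int_f nz_p int_c px0; set c := lead_coef P in int_c.
have nz_c : c != 0 by rewrite lead_coef_eq0.
apply: (@integral_root_monic _ _ _ _ (c^-1 *: P)).
- by rewrite monicE lead_coefZ mulVf.
- by rewrite rootE hornerZ px0 mulr0.
apply/integral_poly => i; rewrite coefZ coef_map.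
by apply: integral_mul => //; apply: int_f.
Qed.

(** By induction on [s]: over [R[t]] it suffices to invert one element [al], and the algebraicity of
    [t] trades [al] for an element of [R]. *)
Lemma adjoin_field_integral s R (f : {rmorphism R -> E}) :
    (forall x, x != 0 -> adjoin_seq s f x -> adjoin_seq s f x^-1) ->
  exists2 b, f b != 0 & {in s, integralRange (adjoin_morph f (f b)^-1)}.
Proof.
elim: s R f => [|t s IHs] R f fieldP /=.
  by exists 1; rewrite // rmorph1 oner_neq0.
have [a nz_a int_s] := IHs _ (adjoin_morph f t) fieldP.
set ft := adjoin_morph f t in nz_a int_s *; set al := ft a in nz_a int_s.
set g := adjoin_morph ft al^-1 in int_s.
have gP r : adjoin_seq s ft (g r).
  have [R' [h hP]] := adjoin_seq_range s ft.
  apply/hP; apply: adjoin_in_range => [c|]; apply/hP; first exact: adjoin_seq_base.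
  exact/fieldP/adjoin_seq_base.
(* The image of [g], that is [R[t, 1/al]], is a field: the inverse exists in the whole extension,
   which is integral over this image by [int_s]. *)
have field_g x : x != 0 -> (exists r, x = g r) -> exists r, x^-1 = g r.
  move=> nz_gr [r Er]; move: nz_gr; rewrite {x}Er => nz_gr; apply: integral_inv_range => //.
  apply: (integral_adjoin_seq _ int_s) (fieldP _ nz_gr (gP r)) => p.
  by rewrite -(adjoin_morphC ft al^-1); apply: integral_id.
have [p nz_p pt0] := adjoin_field_algebraic nz_a field_g.
pose c := p`_(size (map_poly f p)).-1.
have Ec : f c = lead_coef (map_poly f p) by rewrite lead_coefE coef_map.
have nz_c : f c != 0 by rewrite Ec lead_coef_eq0.
pose h := adjoin_morph f (f c)^-1.
have int_h_f r : integralOver h (f r).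
  by rewrite -(adjoin_morphC f (f c)^-1); apply: integral_id.
have int_h_t : integralOver h t.
  apply: integral_root_lead nz_p _ pt0 => //; rewrite -Ec.
  by rewrite -(adjoin_morphX f (f c)^-1); apply: integral_id.
(* Once [c] is inverted, [t] and hence [al] are integral; a nonzero coefficient of the relation for
   [al] is a multiple of [al], so inverting that coefficient also makes [al^-1] integral. *)
have [q mon_q] : integralOver h al by apply: integral_adjoin.
rewrite rootE => /eqP q_al.
have [|i [w [nz_d Ed]]] := root_dvd_coef nz_a _ q_al.
  by rewrite monic_neq0 // monic_map.
have [m [d Edm]] := adjoin_inv_clear q`_i nz_c; rewrite -/h in Edm.
have nz_fd : f d != 0 by rewrite -Edm mulf_neq0 ?expf_neq0.
(* [d] is that coefficient with its powers of [1/c] cleared; inverting [c * d] inverts both [c] and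
   [d]. *)
exists (c * d); first by rewrite rmorphM mulf_neq0.
set k := adjoin_morph f (f (c * d))^-1.
have int_k_f r : integralOver k (f r).
  by rewrite -(adjoin_morphC f (f (c * d))^-1); apply: integral_id.
have int_k_b : integralOver k (f (c * d))^-1.
  by rewrite -[X in integralOver _ X](adjoin_morphX f); apply: integral_id.
have int_k_c : integralOver k (f c)^-1.
  have -> : (f c)^-1 = f d * (f (c * d))^-1.
    by rewrite rmorphM invfM mulrCA mulfV ?mulr1.
  exact: integral_mul.
have int_k_d : integralOver k (f d)^-1.
  have -> : (f d)^-1 = f c * (f (c * d))^-1.
    by rewrite rmorphM invfM mulrA mulfV ?mul1r.
  exact: integral_mul.
have int_k_h r : integralOver k (h r) by apply: integral_adjoin.
have int_k_t : integralOver k t by apply: integral_trans int_h_t.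
have int_k_ft r : integralOver k (ft r) by apply: integral_adjoin.
have int_k_al : integralOver k al^-1.
  have -> : al^-1 = (map_poly h w).[al] * (f c ^+ m * (f d)^-1).
    apply: (mulfI nz_a); rewrite mulfV // mulrA -Ed mulrA Edm mulfV //.
  apply: integral_mul.
    by apply: integral_horner (int_k_ft a); apply: integral_map_poly.
  by apply: integral_mul => //; rewrite -rmorphXn; apply: int_k_f.
move=> u; rewrite inE => /predU1P[-> // | /int_s].
by apply: integral_trans; apply: integral_adjoin.
Qed.

End Adjoin.

(** * Finiteness of fields finitely generated as rings *)

(** Finiteness is expressed by a list containing the set. Tuples over [l] are finite functions into
    [seq_sub l], which can be enumerated; [F] will be a linear combination with varying
    coefficients. *)
Lemma finite_image_ffun (T : choiceType) (T' : eqType) (l : seq T) m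
    (F : ('I_m -> T) -> T') :
  exists l' : seq T', forall r, (forall i, r i \in l) -> F r \in l'.
Proof.
exists [seq F (fun i => val (g i)) | g : {ffun 'I_m -> seq_sub l}] => r lr.
apply/mapP; exists [ffun i => SeqSub (lr i)]; first by rewrite mem_enum.
by congr F; apply: funext => i; rewrite ffunE.
Qed.

(** Division by the monic relation [q] of [t] leaves only remainders of size less than [size q],
    with coefficients from a finite set. *)
Lemma finite_adjoin (E : fieldType) (R : comNzRingType) (f : {rmorphism R -> E})
    t (l : seq E) :
    (forall r, f r \in l) -> integralOver f t ->
  exists l' : seq E, forall p, adjoin_morph f t p \in l'.
Proof.
move=> fl [q mon_q]; rewrite rootE => /eqP qt0.
have [l' l'P] := finite_image_ffun l
  (fun r : 'I_(size q) -> E => \sum_(i < size q) r i * t ^+ i).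
exists l' => p; rewrite (Pdiv.RingMonic.rdivp_eq mon_q p) rmorphD rmorphM /=.
rewrite [adjoin_morph f t q]qt0 mulr0 add0r adjoin_morphE (@horner_coef_wide _ (size q)); last first.
  apply: leq_trans (size_poly _ _) (ltnW _).
  by rewrite Pdiv.Ring.ltn_rmodpN0 ?monic_neq0.
under eq_bigr => i _ do rewrite coef_map.
exact: (l'P (fun i => f _)).
Qed.

Lemma finite_adjoin_seq (E : fieldType) (s : seq E) (R : comNzRingType)
    (f : {rmorphism R -> E}) (l : seq E) :
    (forall r, f r \in l) -> {in s, integralRange f} ->
  exists l' : seq E, forall x, adjoin_seq s f x -> x \in l'.
Proof.
elim: s R f l => [|t s IHs] R f l fl int_s /=.
  by exists l => _ [r ->].
have [|l' l'P] := finite_adjoin fl (t := t); first by apply: int_s; rewrite mem_head.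
apply: IHs l'P _ => u su; apply: (@integral_trans _ _ _ f) => [r|].
  by rewrite -(adjoin_morphC f t); apply: integral_id.
by apply: int_s; rewrite inE su orbT.
Qed.

Lemma pchar0_intr_inj (E : fieldType) :
  [pchar E] =i pred0 -> injective (fun z : int => z%:~R : E).
Proof.
move=> /pcharf0P char0 x y /eqP; rewrite -subr_eq0 -rmorphB /= => /eqP xy0.
apply/eqP; rewrite -subr_eq0 -absz_eq0 -char0; move: xy0; case: (x - y) => k.
  by move=> /eqP; rewrite -pmulrn.
by rewrite NegzE rmorphN /= => /eqP; rewrite oppr_eq0.
Qed.

Lemma pchar_finite_intr (E : fieldType) p :
  p \in [pchar E] -> exists l : seq E, forall z : int, z%:~R \in l.
Proof.
move=> pcharEp; exists [seq i%:R | i <- iota 0 p] => z.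
have p_gt0 := prime_gt0 (pcharf_prime pcharEp).
have nz_p : (p%:Z != 0)%R by rewrite -lt0n in p_gt0 *.
apply/mapP; exists `|(z %% p)%Z|%N.
  rewrite mem_iota /= add0n -ltz_nat gez0_abs ?modz_ge0 // ltz_mod //.
rewrite {1}(divz_eq z p) rmorphD rmorphM /= -[p%:~R]/(p%:R) (pcharf0 pcharEp).
rewrite mulr0 add0r -{1}(gez0_abs (modz_ge0 z nz_p)); exact: pmulrn.
Qed.

Lemma fg_field_finite (E : fieldType) (s : seq E) :
    let P := adjoin_seq s (intr : {rmorphism int -> E}) in
    (forall x, x != 0 -> P x -> P x^-1) ->
  exists l : seq E, forall x, P x -> x \in l.
Proof.
move=> P fieldP; have [b nz_b int_s] := adjoin_field_integral fieldP.
set h := adjoin_morph _ _ in int_s.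
have [[p pcharEp] | char0] := pselect (exists p, p \in [pchar E]).
  have [l lP] := pchar_finite_intr pcharEp.
  have int_h : forall x, integralOver h x -> integralOver (intr : {rmorphism int -> E}) x.
    move=> x; apply: integral_trans; apply: integral_adjoin => [r|].
      exact: integral_id.
    have p_gt1 := prime_gt1 (pcharf_prime pcharEp).
    (* By Fermat, [b ^+ p.-1] is 1 in [E], so [1/b] is already the image of an integer and inverting
       [b] adds nothing. *)
    have -> : (b%:~R : E)^-1 = (b ^+ p.-2)%:~R.
      apply: (mulfI nz_b); rewrite mulfV // -intrM -exprS prednK -?subn1 ?subn_gt0 //.
      apply: (mulfI nz_b); rewrite mulr1 -intrM -exprS subn1 prednK ?(ltnW p_gt1) //.
      by rewrite rmorphXn -(pFrobenius_autE pcharEp) pFrobenius_aut_int.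
    exact: integral_id.
  by apply: finite_adjoin_seq lP _ => x sx; apply/int_h/int_s.
have {}char0 : [pchar E] =i pred0.
  by move=> p; apply/negP => pcharEp; apply: char0; exists p.
(* [1 + b ^+ 2] is prime to [b] and not a unit of [int], so it cannot be
   inverted in the image of [int] localized at [b]. *)
have intr_inj := pchar0_intr_inj char0.
pose u : int := 1 + b * b.
have u_gt1 : 1 < u.
  rewrite ltrDl -expr2 exprn_even_gt0 //=.
  by apply: contraNneq nz_b => ->.
have nz_u : (u%:~R : E) != 0.
  rewrite -[0]/((0 : int)%:~R); apply: contraTneq u_gt1 => /intr_inj ->.
  by [].
have [r Er] : exists r, (u%:~R : E)^-1 = h r.
  have Eu : u%:~R = h u%:P by rewrite adjoin_morphC.
  rewrite Eu; apply: integral_inv_range; rewrite -Eu //.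
  apply: (@integral_adjoin_seq _ _ _ s _ intr) => [z|//|].
    by rewrite -(adjoin_morphC intr (b%:~R)^-1); apply: integral_id.
  by apply: fieldP => //; apply: adjoin_seq_base.
have [m [z]] := adjoin_inv_clear r nz_b; rewrite -/h -Er => Ez.
have /intr_inj Ebm : (b ^+ m)%:~R = (u * z)%:~R :> E.
  by rewrite intrM -Ez mulrA mulfV // mul1r rmorphXn.
have : coprimez u (b ^+ m).
  rewrite coprimezXr // coprimez_sym /coprimez /u addrC gcdzMDl gcdz1 //.
rewrite Ebm /coprimez; have /gcdz_idPl -> : (u %| u * z)%Z by apply: dvdz_mulr.
by rewrite gez0_abs ?(ltW (lt_trans ltr01 u_gt1)) // (gt_eqF u_gt1).
Qed.

(** * Finite subrings of a division ring *)

(** Finiteness makes [L] closed under inverses, so it can be packaged as a finite unit ring; it has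
    no zero divisors, and Wedderburn's theorem applies. *)
Lemma finite_subring_comm (D : unitRingType) (L : D -> Prop) (l : seq D) :
    division_ring D -> L 1 -> (forall x y, L x -> L y -> L (x - y)) ->
    (forall x y, L x -> L y -> L (x * y)) -> (forall x, L x -> x \in l) ->
  forall x y, L x -> L y -> x * y = y * x.
Proof.
move=> divD L1 LB LM finL.
pose l' := [seq x <- l | `[< L x >]].
have l'P x : reflect (L x) (x \in l').
  rewrite mem_filter; apply: (iffP andP) => [[/asboolP] // | Lx].
  by split; [apply/asboolP | apply: finL].
have LX x k : L x -> L (x ^+ k).
  by move=> Lx; elim: k => [|k IHk]; rewrite ?expr0 // exprS; apply: LM.
have LV x : L x -> L x^-1.
  move=> Lx; have [-> | nz_x] := eqVneq x 0; first by rewrite invr0 -(subrr 1); apply: LB.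
  have Ux := divD x nz_x.
  (* Pigeonhole: [(size l).+1] powers of [x] all lie in [l]. Cancelling [x ^+ i] then exhibits
     [x^-1] as a power of [x]. *)
  have [i [j [lt_ij Eij]]] : exists i j : nat, (i < j)%N /\ x ^+ i = x ^+ j.
    have : ~~ uniq [seq x ^+ i | i <- iota 0 (size l).+1].
      apply/negP => uniq_xs; suff: ((size l).+1 <= size l)%N by rewrite ltnn.
      rewrite -[X in (X <= _)%N](size_iota 0) -(size_map (GRing.exp x)).
      by apply: uniq_leq_size => // _ /mapP[i _ ->]; apply/finL/LX.
    case/(uniqPn 0) => i [j [lt_ij]]; rewrite size_map size_iota => lt_j.
    rewrite !(nth_map 0%N) ?size_iota ?(ltn_trans lt_ij) // !nth_iota ?(ltn_trans lt_ij) //.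
    by exists i, j.
  suff -> : x^-1 = x ^+ (j - i).-1 by apply: LX.
  apply: (mulrI Ux); rewrite mulrV // -exprS prednK ?subn_gt0 //.
  by apply: (mulrI (unitrX i Ux)); rewrite mulr1 -exprD subnKC // ltnW.
have closed : GRing.divring_closed [in l'].
  split=> [|x y|x y]; first exact/l'P.
    by move=> /l'P Lx /l'P Ly; apply/l'P/LB.
  by move=> /l'P Lx /l'P Ly; apply/l'P/LM => //; apply: LV.
have [T [v [v_inj vM v0 vP]]] : exists (T : finUnitRingType) (v : T -> D),
    [/\ injective v, {morph v : x y / x * y}, v 0 = 0 &
       forall x, L x -> exists a, x = v a].
  pose U := GRing.SubChoice_isSubUnitRing.Build D _ (seq_sub l') closed.
  pose T : finUnitRingType := HB.pack (seq_sub l') U.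
  exists T, (@ssval _ l'); split=> // [|x /l'P lx]; first exact: val_inj.
  by exists (SeqSub lx).
have domT : GRing.integral_domain_axiom T.
  move=> a b ab0; have [// | nz_a] := eqVneq a 0.
  have /divD Ua : v a != 0 by rewrite -v0 (inj_eq v_inj).
  rewrite -(inj_eq v_inj) v0; apply/eqP/(mulrI Ua).
  by rewrite mulr0 -vM ab0 v0.
by move=> x y /vP[a ->] /vP[b ->]; rewrite -!vM (finDomain_mulrC domT).
Qed.

(** * The center as a field, and bases over it *)

Definition is_subring (D : unitRingType) (L : D -> Prop) : Prop :=
  [/\ L 1, (forall x y, L x -> L y -> L (x - y)) &
      (forall x y, L x -> L y -> L (x * y))].

Lemma is_subring_sum (D : unitRingType) (L : D -> Prop) (I : Type) (r : seq I)
    (F : I -> D) :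
  is_subring L -> (forall i, L (F i)) -> L (\sum_(i <- r) F i).
Proof.
move=> [L1 LB _] LF; have L0 : L 0 by rewrite -(subrr (1 : D)); apply: LB.
apply: (big_ind L) => // x y Lx Ly; rewrite -[y]opprK; apply: (LB) => //.
by rewrite -sub0r; apply: LB.
Qed.

(** Turns the center from a predicate on [D] into a [fieldType] with an embedding, so that the
    results on integrality apply to it. *)
Lemma center_field (D : unitRingType) (K : D -> Prop) :
    division_ring D -> is_division_subring K ->
  exists (E : fieldType) (v : {rmorphism E -> D}),
    forall x, center_of K x <-> exists e, x = v e.
Proof.
move=> divD [K1 KB KM KV].
pose C : pred D := fun x => `[< center_of K x >].
have CP x : reflect (center_of K x) (x \in C) by apply: asboolP.
have closed : GRing.divring_closed C.
  split=> [|x y /CP[Kx Cx] /CP[Ky Cy]|x y /CP[Kx Cx] /CP[Ky Cy]]; apply/CP.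
  - by split=> // k _; rewrite mulr1 mul1r.
  - by split=> [|k Kk]; [apply: KB | rewrite mulrBl mulrBr Cx ?Cy].
  have [-> | nz_y] := eqVneq y 0.
    by rewrite invr0 mulr0 -(subrr 1); split=> [|k _]; [apply: KB | rewrite subrr mulr0 mul0r].
  split=> [|k Kk]; first by apply: KM => //; apply: KV.
  by apply/esym/commrM; [apply/esym/Cx | apply/commrV/esym/Cy].
pose U := GRing.SubChoice_isSubUnitRing.Build D _ {x | C x} closed.
pose T : unitRingType := HB.pack {x | C x} U.
have mulC : @commutative T T *%R.
  move=> [x Cx] [y Cy]; apply: val_inj.
  by have [_ xC] := elimT (CP x) Cx; have [/xC] := elimT (CP y) Cy.
pose Tc : comUnitRingType := HB.pack T (GRing.PzRing_hasCommutativeMul.Build T mulC).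
have fieldT : GRing.field_axiom Tc.
  move=> [x Cx] nz_x; apply/unitrP.
  have nz_x' : x != 0.
    by apply: contraNneq nz_x => x0; apply/eqP/val_inj.
  have [Kx xC] := elimT (CP x) Cx.
  have CxV : C x^-1.
    by apply/CP; split=> [|k Kk]; [apply: KV | apply/esym/commrV/esym/xC].
  by exists (exist _ x^-1 CxV); split; apply: val_inj;
    [apply: mulVr | apply: mulrV]; apply: divD.
pose E : fieldType := HB.pack Tc (GRing.ComUnitRing_isField.Build Tc fieldT).
pose vf : E -> D := @sval D C.
pose v : {rmorphism E -> D} := HB.pack vf
  (GRing.isZmodMorphism.Build E D vf (fun _ _ => erefl))
  (GRing.isMonoidMorphism.Build E D vf (erefl, fun _ _ => erefl)).
exists E, v => x; split=> [/CP Cx | [[y Cy] ->]]; first by exists (exist _ x Cx).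
exact/CP.
Qed.

(** A nontrivial relation allows one vector to be dropped, whence induction on [m]. Independence is
    needed later to compare coordinates. *)
Lemma independent_spanning_family (E : fieldType) (D : nzRingType)
    (v : {rmorphism E -> D}) (K : D -> Prop) m (b : 'I_m -> D) :
    (forall i, K (b i)) ->
    (forall x, K x -> exists c : 'I_m -> E, x = \sum_i v (c i) * b i) ->
  exists m' (b' : 'I_m' -> D),
    [/\ forall i, K (b' i),
        forall x, K x -> exists c : 'I_m' -> E, x = \sum_i v (c i) * b' i &
        forall c : 'I_m' -> E, \sum_i v (c i) * b' i = 0 -> forall i, c i = 0].
Proof.
elim: m b => [|m IHm] b Kb span; first by exists 0%N, b; split=> // c _ [].
have [indep | dep] := pselect (forall c : 'I_m.+1 -> E,
    \sum_i v (c i) * b i = 0 -> forall i, c i = 0); first by exists m.+1, b.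
have [c [c0 [j nz_cj]]] : exists c : 'I_m.+1 -> E,
    \sum_i v (c i) * b i = 0 /\ exists j, c j != 0.
  apply: contrapT => H; apply: dep => c c0 i; apply/eqP/negPn/negP => nz_ci.
  by apply: H; exists c; split=> //; exists i.
apply: (IHm (fun i => b (lift j i))) => // x /span[a Ea].
(* Subtracting [a j / c j] times the relation [c] cancels the coordinate at [j]. *)
exists (fun i => a (lift j i) - a j * (c j)^-1 * c (lift j i)).
have /(congr1 ( *%R (v (a j * (c j)^-1)))) := c0; rewrite mulr0 => Ec.
rewrite mulr_sumr in Ec; rewrite Ea -[LHS]subr0 -[X in _ - X]Ec -sumrB (bigD1_ord j) //=.
rewrite mulrA -rmorphM mulfVK // subrr add0r; apply: eq_bigr => i _.
by rewrite mulrA -rmorphM -mulrBl rmorphB.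
Qed.

(** * Commutativity when the generators capture the center of [D] *)

(** The hypothesis on central elements is all that is kept of the matrix group: [F] lies in the
    subring generated by [X]. *)
Lemma fin_dim_center_fg_comm (D : unitRingType) (K : D -> Prop) (X : seq D) :
    division_ring D -> algebraic_over_center D -> is_division_subring K ->
    fin_dim_over_center K -> (forall x, x \in X -> K x) ->
    (forall a, central a -> forall L, is_subring L ->
       (forall x, x \in X -> L x) -> L a) ->
  forall x y, x \in X -> y \in X -> x * y = y * x.
Proof.
move=> divD algD divK [b0 [Kb0 span0]] KX XF.
have [K1 KB KM KV] := divK.
have ringK : is_subring K by [].
have [E [v vP]] := center_field divD divK.
have vC e k : K k -> v e * k = k * v e.
  by have [_ /(_ k)] : center_of K (v e) by apply/vP; exists e.
have vK e : K (v e) by have [] : center_of K (v e) by apply/vP; exists e.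
have [m [b [Kb span indep]]] : exists m (b : 'I_m -> D),
    [/\ forall i, K (b i),
        forall x, K x -> exists c : 'I_m -> E, x = \sum_i v (c i) * b i &
        forall c : 'I_m -> E, \sum_i v (c i) * b i = 0 -> forall i, c i = 0].
  apply: (@independent_spanning_family _ _ _ _ (size b0) (fun i => b0`_i)) => [i|x /span0].
    exact/Kb0/mem_nth.
  case=> c [Cc ->]; have [c' Ec'] := choice (fun i => (vP (c i)).1 (Cc i)).
  by exists c'; apply: eq_bigr => i _; rewrite -Ec'.
(* Guarding the equation by [K x] makes [coord] total, with zero coordinates outside [K]. *)
have /choice[coord coordP] : forall x, exists c : 'I_m -> E,
    K x -> x = \sum_i v (c i) * b i.
  move=> x; have [/span[c] | nKx] := pselect (K x); first by exists c.
  by exists (fun=> 0).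
have [j nz_u] : exists j, coord 1 j != 0.
  apply: contrapT => H; have /eqP := coordP 1 K1; rewrite big1 ?oner_eq0 // => i _.
  suff -> : coord 1 i = 0 by rewrite rmorph0 mul0r.
  by apply/eqP/negPn/negP => nz; apply: H; exists i.
set u := coord 1 j in nz_u.
pose X' := 1 :: X ++ [seq b ij.1 * b ij.2 | ij : 'I_m * 'I_m].
pose s := u^-1 :: [seq coord x k | x <- X', k <- enum 'I_m].
pose P := adjoin_seq s (intr : {rmorphism int -> E}).
have PX x k : x \in X' -> P (coord x k).
  move=> X'x; apply: adjoin_seq_mem; rewrite inE; apply/orP; right.
  by apply/allpairsP; exists (x, k); rewrite mem_enum.
pose L x := exists r : 'I_m -> E, (forall i, P (r i)) /\ x = \sum_i v (r i) * b i.
have LX' x : K x -> x \in X' -> L x.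
  by move=> Kx X'x; exists (coord x); split=> [i|]; [apply: PX | apply: coordP].
have LK x : L x -> K x.
  case=> r [_ ->]; apply: is_subring_sum => // i; exact: KM.
have LB x y : L x -> L y -> L (x - y).
  move=> [r [Pr ->]] [q [Pq ->]]; exists (fun i => r i - q i); split=> [i|].
    exact: adjoin_seqB (Pr i) (Pq i).
  by rewrite -sumrB; apply: eq_bigr => i _; rewrite rmorphB mulrBl.
have LM x y : L x -> L y -> L (x * y).
  move=> [r [Pr ->]] [q [Pq ->]].
  (* The coordinates of a product, computed from the structure constants [coord (b i * b i')], which
     [s] contains. *)
  exists (fun k => \sum_i \sum_i' r i * q i' * coord (b i * b i') k); split=> [k|].
    apply: adjoin_seq_sum => i; apply: adjoin_seq_sum => i'.
    apply: adjoin_seqM; first exact: adjoin_seqM (Pr i) (Pq i').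
    apply: PX; rewrite inE mem_cat; apply/orP; right; apply/orP; right.
    by apply/mapP; exists (i, i'); rewrite ?mem_enum.
  rewrite mulr_suml; under [RHS]eq_bigr => k _ do rewrite rmorph_sum mulr_suml.
  rewrite exchange_big; apply: eq_bigr => i _.
  rewrite mulr_sumr; under [RHS]eq_bigr => k _ do rewrite rmorph_sum mulr_suml.
  rewrite exchange_big; apply: eq_bigr => i' _.
  rewrite mulrA -(mulrA (v _)) -vC // mulrA -mulrA -rmorphM {1}(coordP (b i * b i')) //; last exact: KM.
  by rewrite mulr_sumr; apply: eq_bigr => k _; rewrite mulrA -rmorphM.
have L1 : L 1 by apply: LX' => //; rewrite mem_head.
have LX x : x \in X -> L x.
  by move=> Xx; apply: LX'; [apply: KX | rewrite inE mem_cat Xx orbT].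
have FP a : central a -> exists2 e, P e & a = v e.
  move=> Ca; have [r [Pr Ea]] := XF a Ca L (And3 L1 LB LM) LX.
  have Ka : K a by apply: LK; exists r.
  have [e Ee] : exists e, a = v e by apply/vP; split=> // k _; apply: Ca.
  exists e => //.
  (* Expanding [a = v e * 1] in the basis and comparing coordinates at [j] gives [e * u = r j];
     dividing by [u] stays in [P] because [u^-1] is in [s]. *)
  have /indep/(_ j) : \sum_i v (e * coord 1 i - r i) * b i = 0.
    under eq_bigr => i _ do rewrite rmorphB rmorphM mulrBl -mulrA.
    by rewrite sumrB -mulr_sumr -coordP // mulr1 -Ea Ee subrr.
  move/eqP; rewrite subr_eq0 -/u => /eqP eu.
  rewrite -[e](mulfK nz_u) eu; apply: adjoin_seqM (Pr j) _.
  by apply: adjoin_seq_mem; rewrite mem_head.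
have fieldP x : x != 0 -> P x -> P x^-1.
  move=> nz_x Px; have [p [nz_p [Cp px0]]] := algD (v x).
  have [R [f fP]] := adjoin_seq_range s (intr : {rmorphism int -> E}).
  (* The algebraic relation has coefficients in [F], hence in the image of [P], and is pulled back
     to a polynomial over [R]. *)
  have /choice[q Eq] : forall i, exists r, p`_i = v (f r).
    by move=> i; have [e /fP[r ->] ->] := FP _ (Cp i); exists r.
  pose Q := \poly_(i < size p) q i.
  have Qx : v (map_poly f Q).[x] = p.[v x].
    rewrite (@horner_coef_wide _ (size p)) ?(leq_trans (size_poly _ _)) ?size_poly //.
    rewrite horner_coef rmorph_sum; apply: eq_bigr => i _.
    by rewrite coef_map coef_poly ltn_ord /= rmorphM rmorphXn Eq.
  have nz_Q : map_poly f Q != 0.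
    apply: contraNneq nz_p => Q0; apply/eqP/polyP => i; rewrite coef0.
    have [le_p | lt_i] := leqP (size p) i; first by rewrite nth_default.
    have := coef_map f Q i; rewrite Q0 coef0 coef_poly lt_i Eq /= => <-.
    exact: rmorph0.
  have [|i [w [nz_d Ed]]] := root_dvd_coef nz_x nz_Q.
    by apply: (fmorph_inj v); rewrite Qx px0 rmorph0.
  have lt_i : (i < size p)%N.
    by move: nz_d; rewrite coef_poly; case: ifP => //; rewrite rmorph0 eqxx.
  have Ep : p`_i = v (f Q`_i) by rewrite Eq coef_poly lt_i.
  (* The coefficient that is a multiple of [x] is central in [D], and so is its inverse; [FP]
     therefore puts the inverse in [P], and [x^-1] is obtained from it. *)
  have [e Pe Ee] : exists2 e, P e & (p`_i)^-1 = v e.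
    by apply: FP => y; apply/esym/commrV/esym/Cp.
  have -> : x^-1 = (map_poly f w).[x] * e.
    have -> : e = (f Q`_i)^-1.
      by apply: (fmorph_inj v); rewrite -Ee Ep fmorphV.
    by apply: (mulfI nz_x); rewrite mulfV // mulrA -Ed mulfV.
  apply: adjoin_seqM (Pe); rewrite horner_coef; apply: adjoin_seq_sum => k.
  apply: adjoin_seqM; first by rewrite coef_map; apply/fP; exists w`_k.
  by case/fP: Px => r ->; rewrite -rmorphXn; apply/fP; exists (r ^+ k).
have [l lP] := fg_field_finite fieldP.
have [l' l'P] := finite_image_ffun l (fun r : 'I_m -> E => \sum_i v (r i) * b i).
move=> x y /LX Lx /LX Ly; apply: (@finite_subring_comm _ L l') => //.
by move=> _ [r [Pr ->]]; apply: l'P => i; apply/lP/Pr.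
Qed.

(** * Generated division subrings and matrix groups *)

Lemma gen_division_subring_is_division_subring (D : unitRingType) (S : seq D) :
  is_division_subring (gen_division_subring S).
Proof.
split=> [T [] // | x y Sx Sy T divT ST | x y Sx Sy T divT ST | x Sx nz_x T divT ST].
- by have [_ TB _ _] := divT; apply: TB; [apply: Sx | apply: Sy].
- by have [_ _ TM _] := divT; apply: TM; [apply: Sx | apply: Sy].
by have [_ _ _ TV] := divT; apply: TV nz_x; apply: Sx.
Qed.

(** [L] need not be closed under inverses, so entries in [L] are required of the inverse matrix as
    well. *)
Lemma subring_matrices_subgroup_GL (D : unitRingType) n (L : D -> Prop) :
    is_subring L ->
  is_subgroup_GL (fun A : 'M[D]_n => exists B : 'M[D]_n,
    [/\ A *m B = 1%:M, B *m A = 1%:M, forall i j, L (A i j) &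
        forall i j, L (B i j)]).
Proof.
move=> ringL; have [L1 LB LM] := ringL.
have LI i j : L ((1%:M : 'M[D]_n) i j).
  by rewrite mxE; case: eqP => // _; rewrite mulr0n -(subrr (1 : D)); apply: LB.
have LmulM (A B : 'M[D]_n) : (forall i j, L (A i j)) -> (forall i j, L (B i j)) ->
    forall i j, L ((A *m B) i j).
  by move=> LA LB' i j; rewrite mxE; apply: is_subring_sum => // k; apply: LM.
split.
- by move=> A [B [AB BA _ _]]; exists B.
- by exists 1%:M; split; rewrite ?mulmx1.
- move=> A1 A2 [B1 [AB1 BA1 LA1 LB1]] [B2 [AB2 BA2 LA2 LB2]].
  exists (B2 *m B1); split; try exact: LmulM.
    by rewrite mulmxA -(mulmxA A1) AB2 mulmx1.
  by rewrite mulmxA -(mulmxA B2) BA1 mulmx1.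
move=> A B [B' [AB' B'A LA LB']] AB BA.
suff -> : B = B' by exists A.
by rewrite -[B]mul1mx -B'A -mulmxA AB mulmx1.
Qed.

Theorem theorem5p9 (D : unitRingType) (hdiv : division_ring D)
  (hnc : noncommutative D) (halg : algebraic_over_center D)
  (hwlf : weakly_locally_finite D) (n : nat) (hn : (0 < n)%N)
  (N : 'M[D]_n -> Prop) (hN : is_subgroup_GL N)
  (hF : forall a : D, central a -> a != 0 -> N a%:M) :
  ~ finitely_generated_GL N.
Proof.
case=> s [sN genN]; have [x [y /eqP xy]] := hnc.
have [N_GL _ _ _] := hN.
have /choice[inv invP] : forall A : 'M[D]_n, exists B : 'M[D]_n,
    A \in s -> A *m B = 1%:M /\ B *m A = 1%:M.
  move=> A; have [/sN/N_GL[B] | //] := boolP (A \in s); first by exists B.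
  by exists A.
pose entries (A : 'M[D]_n) := [seq A ij.1 ij.2 | ij : 'I_n * 'I_n].
have entriesP (A : 'M[D]_n) i j : A i j \in entries A.
  by apply/mapP; exists (i, j); rewrite ?mem_enum.
pose X := x :: y :: flatten [seq entries A ++ entries (inv A) | A <- s].
have sX A : A \in s -> {subset entries A ++ entries (inv A) <= X}.
  move=> sA z Az; rewrite !inE; apply/orP; right; apply/orP; right.
  by apply/flattenP; exists (entries A ++ entries (inv A)) => //; apply: map_f.
apply: xy; apply: (@fin_dim_center_fg_comm D (gen_division_subring X) X) => //.
- exact: gen_division_subring_is_division_subring.
- by move=> z Xz T _; apply.
- move=> a Ca L ringL LX; have [L1 LB _] := ringL.
  have [-> | nz_a] := eqVneq a 0; first by rewrite -(subrr (1 : D)); apply: LB.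
  (* Minimality of [N] is applied to the group of matrices that, together with their inverses, have
     entries in [L]. It contains the generators since [X] lists the entries of both, so it contains
     [a%:M]. *)
  have [A sA | B [_ _ La _]] :=
      genN _ (subring_matrices_subgroup_GL n ringL) _ _ (hF a Ca nz_a).
    have [AB BA] := invP A sA.
    exists (inv A); split=> // i j; apply/LX/(sX A sA).
      by rewrite mem_cat entriesP.
    by rewrite mem_cat entriesP orbT.
  (* As [n] is positive, [a] occurs as a diagonal entry of [a%:M]. *)
  by have := La (Ordinal hn) (Ordinal hn); rewrite mxE eqxx.
- by rewrite mem_head.
by rewrite !inE eqxx orbT.
Qed.
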